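(* Let $n\geq 3$, let $t$ be an indeterminate, and let $\eta_1:T_n\rightarrow\mathrm{GL}_n(\mathbb{Z}[t^{\pm1}])$ be the representation of the twin group given by $\eta_1(s_i)=\left(\begin{array}{c|c|c} I_{i-1} & 0 & 0\\ \hline 0 & \begin{matrix}1-t & t\\ 2-t & t-1\end{matrix} & 0\\ \hline 0&0&I_{n-i-1}\end{array}\right)$ for $1\leq i\leq n-1$. Let $\hat{\eta}_1:VT_n\rightarrow\mathrm{GL}_n(\mathbb{Z}[t^{\pm1}])$ be a $2$-local representation of the virtual twin group $VT_n$ that extends $\eta_1$ (i.e. $\hat\eta_1(s_i)=\eta_1(s_i)$ for all $i$). Then there is an invertible element $b\in\mathbb{Z}[t^{\pm1}]$ such that, for all $1\leq i\leq n-1$, $$\hat{\eta}_1(s_i)=\left(\begin{array}{c|c|c} I_{i-1} & 0 & 0\\ \hline 0 & \begin{matrix}1-t & t\\ 2-t & t-1\end{matrix} & 0\\ \hline 0&0&I_{n-i-1}\end{array}\right),\qquad \hat{\eta}_1(\rho_i)=\left(\begin{array}{c|c|c} I_{i-1} & 0 & 0\\ \hline 0 & \begin{matrix}0 & b\\ \frac1b & 0\end{matrix} & 0\\ \hline 0&0&I_{n-i-1}\end{array}\right).$$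
   Context: The twin group $T_n$ has generators $s_1,\ldots,s_{n-1}$ and relations $s_i^2=1$ ($1\le i\le n-1$), $s_is_j=s_js_i$ ($|i-j|\geq2$). The virtual twin group $VT_n$ has generators $s_1,\ldots,s_{n-1},\rho_1,\ldots,\rho_{n-1}$, with the relations of $T_n$ together with: $\rho_i\rho_{i+1}\rho_i=\rho_{i+1}\rho_i\rho_{i+1}$ ($1\le i\le n-2$); $\rho_i\rho_j=\rho_j\rho_i$ ($|i-j|\geq 2$); $\rho_i^2=1$ ($1\le i\le n-1$); $s_i\rho_j=\rho_js_i$ ($|i-j|\geq2$); $\rho_i\rho_{i+1}s_i=s_{i+1}\rho_i\rho_{i+1}$ ($1\le i\le n-2$). A representation $\theta:VT_n\to\mathrm{GL}_n(\mathbb{Z}[t^{\pm1}])$ is $2$-local if for each $1\leq i\leq n-1$ there are $M_i,N_i\in\mathrm{GL}_2(\mathbb{Z}[t^{\pm1}])$ with $\theta(s_i)=\mathrm{diag}(I_{i-1},M_i,I_{n-i-1})$ and $\theta(\rho_i)=\mathrm{diag}(I_{i-1},N_i,I_{n-i-1})$ (block diagonal). $I_r$ is the $r\times r$ identity matrix. *)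

(* Defs.v *)
From HB Require Import structures.
From mathcomp Require Import all_boot all_order all_algebra.
From mathcomp Require Import boolp.
Set Implicit Arguments.
Unset Strict Implicit.
Unset Printing Implicit Defensive.
Import Order.TTheory GRing.Theory Num.Theory.
Local Open Scope quotient_scope.
Local Open Scope ring_scope.

(* A word over the alphabet [G]; the letter [(x, true)] stands for [x] and
   [(x, false)] for [x^-1]. *)
Definition word (G : Type) := seq (G * bool).

Definition posword (G : Type) (s : seq G) : word G := [seq (x, true) | x <- s].

Section Presentation.
Variables (G : choiceType) (r : seq G -> seq G -> Prop).

(* The least congruence on words containing free cancellation and [r].  The
   relators are pairs of positive words, read as equations [u = v]. *)
Inductive pcong : word G -> word G -> Prop :=
| pcong_refl u : pcong u u
| pcong_sym u v : pcong u v -> pcong v u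
| pcong_trans u v w : pcong u v -> pcong v w -> pcong u w
| pcong_cat u u' v v' : pcong u u' -> pcong v v' -> pcong (u ++ v) (u' ++ v')
| pcong_cancel x b : pcong [:: (x, b); (x, ~~ b)] [::]
| pcong_rel u v : r u v -> pcong (posword u) (posword v).

Definition pcongb : rel (seq (G * bool)) := fun u v => `[< pcong u v >].

Lemma pcongb_refl : reflexive pcongb.
Proof. by move=> u; apply/asboolP; exact: pcong_refl. Qed.

Lemma pcongb_sym : symmetric pcongb.
Proof. by move=> u v; apply: asbool_equiv_eq; split; exact: pcong_sym. Qed.

Lemma pcongb_trans : transitive pcongb.
Proof.
move=> v u w /asboolP uv /asboolP vw; apply/asboolP; exact: pcong_trans uv vw.
Qed.

Canonical pcongb_equiv := EquivRel pcongb pcongb_refl pcongb_sym pcongb_trans.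

Definition pgroup := {eq_quot pcongb}.
HB.instance Definition _ : EqQuotient _ pcongb pgroup := EqQuotient.on pgroup.
HB.instance Definition _ := Choice.on pgroup.

Definition pclass (u : word G) : pgroup := \pi_({eq_quot pcongb}) u.
Definition prepr (c : pgroup) : word G := repr (c : {eq_quot pcongb}).

Lemma preprK : cancel prepr pclass.
Proof. exact: reprK. Qed.

Lemma pclassP u v : pclass u = pclass v <-> pcong u v.
Proof.
by split=> [/eqquotP/asboolP //|uv]; apply/eqquotP; apply/asboolP.
Qed.

Definition pone : pgroup := pclass [::].
Definition pmul (a b : pgroup) : pgroup := pclass (prepr a ++ prepr b).
Definition winv (u : word G) : word G := rev [seq (x.1, ~~ x.2) | x <- u].
Definition pinv (a : pgroup) : pgroup := pclass (winv (prepr a)).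

Lemma pmul_class u v : pmul (pclass u) (pclass v) = pclass (u ++ v).
Proof.
by apply/pclassP; apply: pcong_cat; apply/pclassP; exact: preprK.
Qed.

Lemma winvK : involutive winv.
Proof.
move=> u; rewrite /winv map_rev revK -map_comp -[RHS]map_id.
by apply: eq_map => -[x b] /=; rewrite negbK.
Qed.

Lemma pcong_mulwV u : pcong (u ++ winv u) [::].
Proof.
elim: u => [|[x b] u IHu]; first exact: pcong_refl.
have -> : ((x, b) :: u) ++ winv ((x, b) :: u) =
    [:: (x, b)] ++ ((u ++ winv u) ++ [:: (x, ~~ b)]).
  by rewrite /winv /= rev_cons -cats1 catA.
apply: pcong_trans (pcong_cancel x b).
apply: (@pcong_cat _ [:: (x, b)] _ [:: (x, ~~ b)]); first exact: pcong_refl.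
by apply: (@pcong_cat _ [::] _ [:: (x, ~~ b)]) => //; exact: pcong_refl.
Qed.

Lemma pmulA : associative pmul.
Proof.
move=> a b c; rewrite -[a]preprK -[b]preprK -[c]preprK.
by rewrite !pmul_class catA.
Qed.

Lemma pmul1 : left_id pone pmul.
Proof. by move=> a; rewrite -[a]preprK pmul_class. Qed.

Lemma pmulr1 : right_id pone pmul.
Proof. by move=> a; rewrite -[a]preprK pmul_class cats0. Qed.

Lemma pmulV : left_inverse pone pinv pmul.
Proof.
move=> a; rewrite -[X in pmul _ X]preprK pmul_class; apply/pclassP.
by rewrite -[X in _ ++ X]winvK; exact: pcong_mulwV.
Qed.

Lemma pmulrV : right_inverse pone pinv pmul.
Proof.
move=> a; rewrite -[X in pmul X _]preprK pmul_class; apply/pclassP.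
exact: pcong_mulwV.
Qed.

HB.instance Definition _ :=
  isGroup.Build pgroup pmulA pmul1 pmulr1 pmulV pmulrV.

Definition pgen (x : G) : pgroup := pclass [:: (x, true)].

End Presentation.

(* The generators are indexed from [0]: [i : 'I_n.-1] stands for the index
   [i + 1]. *)
Inductive twin_rel (n : nat) : seq 'I_n.-1 -> seq 'I_n.-1 -> Prop :=
| twin_sq i : twin_rel [:: i; i] [::]
| twin_comm (i j : 'I_n.-1) : (2 <= `|i - j|)%N -> twin_rel [:: i; j] [:: j; i].

Definition twin_group (n : nat) := pgroup (@twin_rel n).
HB.instance Definition _ n := Group.on (twin_group n).

Definition twin_s n (i : 'I_n.-1) : twin_group n := pgen (@twin_rel n) i.

(* [inl i] is the letter of [s_i] and [inr i] that of [rho_i]. *)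
Inductive vtwin_rel (n : nat) :
  seq ('I_n.-1 + 'I_n.-1) -> seq ('I_n.-1 + 'I_n.-1) -> Prop :=
| vtwin_twin u v : twin_rel u v -> vtwin_rel (map inl u) (map inl v)
| vtwin_braid (i j : 'I_n.-1) : j = i.+1 :> nat ->
    vtwin_rel [:: inr i; inr j; inr i] [:: inr j; inr i; inr j]
| vtwin_rcomm (i j : 'I_n.-1) : (2 <= `|i - j|)%N ->
    vtwin_rel [:: inr i; inr j] [:: inr j; inr i]
| vtwin_rsq i : vtwin_rel [:: inr i; inr i] [::]
| vtwin_srcomm (i j : 'I_n.-1) : (2 <= `|i - j|)%N ->
    vtwin_rel [:: inl i; inr j] [:: inr j; inl i]
| vtwin_mixed (i j : 'I_n.-1) : j = i.+1 :> nat ->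
    vtwin_rel [:: inr i; inr j; inl i] [:: inl j; inr i; inr j].

Definition vtwin_group (n : nat) := pgroup (@vtwin_rel n).
HB.instance Definition _ n := Group.on (vtwin_group n).

Definition vtwin_s n (i : 'I_n.-1) : vtwin_group n :=
  pgen (@vtwin_rel n) (inl i).
Definition vtwin_rho n (i : 'I_n.-1) : vtwin_group n :=
  pgen (@vtwin_rel n) (inr i).

Local Notation "x %:F" := (@FracField.tofrac _ x).

(* The subring of Z(t) of the fractions [p / t^k]. *)
Definition is_laurent : {pred {fraction {poly int}}} :=
  fun f => `[< exists (p : {poly int}) (k : nat),
                 f = (p%:F / ('X^k)%:F)%R >].

Lemma is_laurentP f : reflect
  (exists (p : {poly int}) (k : nat), f = p%:F / ('X^k)%:F) (f \in is_laurent).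
Proof. exact: asboolP. Qed.

Lemma fracXn_neq0 k : ('X^k : {poly int})%:F != 0.
Proof. by rewrite tofrac_eq0 monic_neq0 // monicXn. Qed.

Lemma is_laurent_subring : subring_closed is_laurent.
Proof.
split.
- by apply/is_laurentP; exists 1, 0; rewrite expr0 tofrac1 divr1.
- move=> _ _ /is_laurentP[p [k ->]] /is_laurentP[q [l ->]].
  apply/is_laurentP; exists (p * 'X^l - q * 'X^k), (k + l)%N.
  rewrite exprD tofracM tofracB !tofracM mulrBl.
  by rewrite -mulf_div divff ?fracXn_neq0 // mulr1
     [_%:F * _%:F in X in _ = _ - X]mulrC -mulf_div divff ?fracXn_neq0 // mul1r.
- move=> _ _ /is_laurentP[p [k ->]] /is_laurentP[q [l ->]].
  apply/is_laurentP; exists (p * q), (k + l)%N.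
  by rewrite exprD !tofracM mulf_div.
Qed.

HB.instance Definition _ :=
  GRing.isSubringClosed.Build _ is_laurent is_laurent_subring.

Record laurent :=
  Laurent { laurent_val :> {fraction {poly int}};
            laurent_valP : laurent_val \in is_laurent }.

HB.instance Definition _ := [isSub for laurent_val].
HB.instance Definition _ := [Choice of laurent by <:].
HB.instance Definition _ := [SubChoice_isSubComNzRing of laurent by <:].

Lemma laurent_val1 : laurent_val 1 = 1.
Proof. exact: (rmorph1 (\val : laurent -> _)). Qed.

Lemma laurent_valM f g : laurent_val (f * g) = laurent_val f * laurent_val g.
Proof. exact: (rmorphM (\val : laurent -> _)). Qed.

Definition laurent_unit : pred laurent :=
  fun f => (laurent_val f != 0) && ((laurent_val f)^-1 \in is_laurent).
Definition laurent_inv (f : laurent) : laurent :=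
  if laurent_unit f then insubd f (laurent_val f)^-1 else f.

Lemma laurent_mulV : {in laurent_unit, left_inverse 1 laurent_inv *%R}.
Proof.
move=> f uf; apply: val_inj.
apply: etrans (laurent_valM _ _) (etrans _ (esym laurent_val1)).
rewrite /laurent_inv.
have -> : laurent_unit f = true by exact: uf.
case/andP: uf => f0 fV.
have -> : laurent_val (insubd f (laurent_val f)^-1) = (laurent_val f)^-1.
  exact: insubdK.
exact: mulVf.
Qed.

Lemma laurent_unitP (f g : laurent) : g * f = 1 -> laurent_unit f.
Proof.
move=> /(congr1 laurent_val); rewrite laurent_valM laurent_val1 => gf1.
have f0 : laurent_val f != 0.
  by apply: contra_eq_neq gf1 => ->; rewrite mulr0 eq_sym oner_eq0.
rewrite /laurent_unit f0 /=.
by rewrite -[(laurent_val f)^-1]mul1r -gf1 mulfK //; exact: valP.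
Qed.

Lemma laurent_invN : {in [predC laurent_unit], laurent_inv =1 id}.
Proof. by move=> f uf; rewrite /laurent_inv ifN. Qed.

HB.instance Definition _ := GRing.ComNzRing_hasMulInverse.Build laurent
  laurent_mulV laurent_unitP laurent_invN.
HB.instance Definition _ := [SubComUnitRing_isSubIntegralDomain of laurent by <:].

Lemma laurent_t_subproof : ('X : {poly int})%:F \in is_laurent.
Proof. by apply/is_laurentP; exists 'X, 0; rewrite expr0 tofrac1 divr1. Qed.

Definition laurent_t : laurent := Laurent laurent_t_subproof.

Record GL (R : comUnitRingType) (n : nat) :=
  MkGL { GL_val :> 'M[R]_n; GL_valP : GL_val \in unitmx }.

HB.instance Definition _ R n := [isSub for @GL_val R n].
HB.instance Definition _ R n := [Choice of GL R n by <:].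

Section GLgroup.
Variables (R : comUnitRingType) (n : nat).
Implicit Types A B C : GL R n.

Definition GL_one : GL R n := MkGL (unitmx1 R n).

Lemma GL_mul_subproof A B : (A : 'M_n) *m B \in unitmx.
Proof. by rewrite unitmx_mul !GL_valP. Qed.
Definition GL_mul A B : GL R n := MkGL (GL_mul_subproof A B).

Lemma GL_inv_subproof A : invmx A \in unitmx.
Proof. by rewrite unitmx_inv GL_valP. Qed.
Definition GL_inv A : GL R n := MkGL (GL_inv_subproof A).

Lemma GL_mulA : associative GL_mul.
Proof. by move=> A B C; apply: val_inj; exact: mulmxA. Qed.
Lemma GL_mul1 : left_id GL_one GL_mul.
Proof. by move=> A; apply: val_inj; exact: mul1mx. Qed.
Lemma GL_mulr1 : right_id GL_one GL_mul.
Proof. by move=> A; apply: val_inj; exact: mulmx1. Qed.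
Lemma GL_mulV : left_inverse GL_one GL_inv GL_mul.
Proof. by move=> A; apply: val_inj; apply: mulVmx; exact: GL_valP. Qed.
Lemma GL_mulrV : right_inverse GL_one GL_inv GL_mul.
Proof. by move=> A; apply: val_inj; apply: mulmxV; exact: GL_valP. Qed.

HB.instance Definition _ :=
  isGroup.Build (GL R n) GL_mulA GL_mul1 GL_mulr1 GL_mulV GL_mulrV.
End GLgroup.

Definition mx22 (R : Type) (a b c d : R) : 'M[R]_2 :=
  \matrix_(i < 2, j < 2)
    if i == 0 then (if j == 0 then a else b) else (if j == 0 then c else d).

(* The block diagonal matrix diag(I_i, M, I_(n - i - 2)): [M] occupies the
   rows and columns [i] and [i.+1]. *)
Definition local2 (R : pzRingType) (n : nat) (i : 'I_n.-1) (M : 'M[R]_2) :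
    'M[R]_n :=
  \matrix_(j, k)
    if (i <= j <= i.+1)%N && (i <= k <= i.+1)%N
    then M (inord (j - i)) (inord (k - i)) else (j == k)%:R.

Definition two_local (n : nat)
    (theta : {multiplicative vtwin_group n -> GL laurent n}) : Prop :=
  forall i : 'I_n.-1, exists M N : GL laurent 2,
    (theta (vtwin_s i) : 'M_n) = local2 i M /\
    (theta (vtwin_rho i) : 'M_n) = local2 i N.

Definition eta1_block : 'M[laurent]_2 :=
  mx22 (1 - laurent_t) laurent_t (2 - laurent_t) (laurent_t - 1).

(* Main.v *)
Require Import Defs.
From mathcomp Require Import all_boot all_order all_algebra.
From mathcomp Require Import fraction ring zify.
Import GRing.Theory.
Local Open Scope ring_scope.

(** Write [theta] for the extension and [N_i] for the 2x2 block of
    [theta (rho_i)], let [M] be the common block of the [theta (s_i)], and put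
    [N_i = (a b; c d)], [N_(i+1) = (a' b'; c' d')].

    The mixed relation [rho_i rho_(i+1) s_i = s_(i+1) rho_i rho_(i+1)] only
    involves the three coordinates [i, i+1, i+2].  Reading four of its nine
    entries, and cancelling [t] and [2 - t], which are nonzero in the domain
    Z[t, 1/t], gives
      [d a' = 0],  [c' = c],  [d' = d b'],  [t a = (2 - t) b a'].
    The relations [rho_i^2 = rho_(i+1)^2 = 1] say [N_i^2 = N_(i+1)^2 = 1].
    One of [d] and [a'] vanishes.  If [d = 0], then [c b = 1] and [a b = 0], so
    [a = 0] and in turn [b a' = 0], [a' = 0].  If [a' = 0], then [t a = 0], so
    [a = 0], [b c = 1] and [b d = 0], whence [d = 0].  In both cases
    [d' = d b' = 0] and [b' c = b' c' = 1 = b c], so [b' = b]: the two adjacent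
    blocks are equal, and antidiagonal with mutually inverse entries
    ([adjacent_antidiagonal]).  As [n >= 3], there are at least two indices, so
    the block of [rho_1] has this form, and it propagates from each index to
    the next one. *)

(** * Entries and products of block diagonal matrices *)

Section Local2.
Context {R : pzRingType} {n : nat} {i : 'I_n.-1} {x y : 'I_n}.
Context (hx : x = i :> nat) (hy : y = i.+1 :> nat).
Implicit Types (M : 'M[R]_2) (X : 'M[R]_n).

Lemma local2_00 M : local2 i M x x = M 0 0.
Proof.
rewrite mxE hx leqnn leqnSn subnn /=.
by have -> : inord 0 = 0 :> 'I_2 by apply/val_inj; rewrite /= inordK.
Qed.

Lemma local2_01 M : local2 i M x y = M 0 1.
Proof.
rewrite mxE hx hy leqnn leqnSn leqnn subnn subSnn /=.
have -> : inord 0 = 0 :> 'I_2 by apply/val_inj; rewrite /= inordK.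
by have -> : inord 1 = 1 :> 'I_2 by apply/val_inj; rewrite /= inordK.
Qed.

Lemma local2_10 M : local2 i M y x = M 1 0.
Proof.
rewrite mxE hx hy leqnn leqnSn leqnn subnn subSnn /=.
have -> : inord 0 = 0 :> 'I_2 by apply/val_inj; rewrite /= inordK.
by have -> : inord 1 = 1 :> 'I_2 by apply/val_inj; rewrite /= inordK.
Qed.

Lemma local2_11 M : local2 i M y y = M 1 1.
Proof.
rewrite mxE hy leqnn leqnSn subSnn /=.
by have -> : inord 1 = 1 :> 'I_2 by apply/val_inj; rewrite /= inordK.
Qed.

Lemma local2_outl M (z k : 'I_n) : ~~ (i <= z <= i.+1)%N ->
  local2 i M z k = (z == k)%:R.
Proof. by move=> hz; rewrite mxE (negbTE hz). Qed.

Lemma local2_outr M (z k : 'I_n) : ~~ (i <= k <= i.+1)%N ->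
  local2 i M z k = (z == k)%:R.
Proof. by move=> hk; rewrite mxE (negbTE hk) andbF. Qed.

(** Left multiplication by [local2 i M] is a row operation on the rows [i] and
    [i.+1], so that entries of products of such matrices need no sums. *)
Lemma mul_local2_in M X (z k : 'I_n) :
  (i <= z <= i.+1)%N ->
  (local2 i M *m X) z k = local2 i M z x * X x k + local2 i M z y * X y k.
Proof.
move=> hz; have neq_yx : y != x by rewrite -val_eqE /= hx hy; lia.
rewrite mxE (bigD1 x) //= (bigD1 y) //= big1 ?addr0 // => k'.
rewrite -!val_eqE /= hx hy => /andP[kx ky].
rewrite local2_outr; last lia.
suff /negbTE-> : z != k' by rewrite mul0r.
by rewrite -val_eqE /=; lia.
Qed.

Lemma mul_local2_0 M X k :
  (local2 i M *m X) x k = M 0 0 * X x k + M 0 1 * X y k.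
Proof. by rewrite mul_local2_in ?local2_00 ?local2_01 // hx; lia. Qed.

Lemma mul_local2_1 M X k :
  (local2 i M *m X) y k = M 1 0 * X x k + M 1 1 * X y k.
Proof. by rewrite mul_local2_in ?local2_10 ?local2_11 // hy; lia. Qed.

Lemma mul_local2_out M X (z k : 'I_n) : ~~ (i <= z <= i.+1)%N ->
  (local2 i M *m X) z k = X z k.
Proof.
move=> hz; rewrite mxE (bigD1 z) //= big1 => [|k' hk'].
  by rewrite local2_outl // eqxx mul1r addr0.
by rewrite local2_outl // eq_sym (negbTE hk') mul0r.
Qed.

End Local2.

(** * Group relations entry by entry *)

Section Relations.
Context {R : pzRingType} {n : nat}.

Lemma local2_sqr1 {i : 'I_n.-1} {x y : 'I_n} {N : 'M[R]_2} :
  x = i :> nat -> y = i.+1 :> nat ->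
  local2 i N *m local2 i N = 1%:M ->
  [/\ N 0 0 * N 0 0 + N 0 1 * N 1 0 = 1, N 0 0 * N 0 1 + N 0 1 * N 1 1 = 0,
      N 1 0 * N 0 0 + N 1 1 * N 1 0 = 0 & N 1 0 * N 0 1 + N 1 1 * N 1 1 = 1].
Proof.
move=> hx hy /matrixP sqN.
have neq_xy : (x == y) = false by rewrite -val_eqE /= hx hy; lia.
split; [move: (sqN x x) | move: (sqN x y) | move: (sqN y x) | move: (sqN y y)];
  rewrite (mul_local2_0 hx hy, mul_local2_1 hx hy)
    ?(local2_00 hx, local2_01 hx hy, local2_10 hx hy, local2_11 hy) mxE;
  by rewrite ?eqxx ?(eq_sym y x) ?neq_xy.
Qed.

(** With [N], [N'] the blocks of [rho_i], [rho_(i+1)] and [M] that of the [s_i],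
    these are the entries (1,1), (2,1), (2,2) and (2,3) of the mixed relation on
    the coordinates [x, y, z]: together with the involutions, they suffice to
    determine [N] and [N']. *)
Lemma local2_mixed {i j : 'I_n.-1} {x y z : 'I_n} {M N N' : 'M[R]_2} :
  x = i :> nat -> y = i.+1 :> nat -> z = i.+2 :> nat -> j = i.+1 :> nat ->
  local2 i N *m (local2 j N' *m local2 i M) =
    local2 j M *m (local2 i N *m local2 j N') ->
  [/\ N 0 0 * M 0 0 + N 0 1 * (N' 0 0 * M 1 0) = N 0 0,
      N 1 0 * M 0 0 + N 1 1 * (N' 0 0 * M 1 0) = M 0 0 * N 1 0,
      N 1 0 * M 0 1 + N 1 1 * (N' 0 0 * M 1 1) =
        M 0 0 * (N 1 1 * N' 0 0) + M 0 1 * N' 1 0 &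
      N 1 1 * N' 0 1 = M 0 0 * (N 1 1 * N' 0 1) + M 0 1 * N' 1 1].
Proof.
move=> hx hy hz hj /matrixP mixed.
have hy' : y = j :> nat by rewrite hj.
have hz' : z = j.+1 :> nat by rewrite hj.
have outx : ~~ (j <= x <= j.+1)%N by rewrite hx hj; lia.
have outz : ~~ (i <= z <= i.+1)%N by rewrite hz; lia.
have neqs : ((x == y) = false) * ((x == z) = false) * ((y == z) = false)
  * ((y == x) = false) * ((z == x) = false) * ((z == y) = false).
  by rewrite -!val_eqE /= hx hy hz; do !split; lia.
pose mulE := (mul_local2_0 hx hy, mul_local2_1 hx hy, mul_local2_out _ _ z _ outz,
  mul_local2_0 hy' hz', mul_local2_1 hy' hz', mul_local2_out _ _ x _ outx).
pose entE := (local2_00 hx, local2_01 hx hy, local2_10 hx hy, local2_11 hy,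
  local2_00 hy', local2_01 hy' hz', local2_10 hy' hz', local2_11 hz').
pose outE := (local2_outl _ x _ outx, local2_outr _ _ x outx,
  local2_outl _ z _ outz, local2_outr _ _ z outz).
pose simp := (mulE, entE, outE, neqs, eqxx, mulr0, mulr1, mul0r, add0r, addr0).
by split; [move: (mixed x x) | move: (mixed y x) | move: (mixed y y)
  | move: (mixed y z)]; rewrite !simp.
Qed.

End Relations.

(** * Two adjacent blocks *)

(** The blocks are [(a b; c d)] and [(a' b'; c' d')], and the hypotheses are
    entries of the mixed relation and of the two involutions.  They force
    [d * a' = 0], and either factor being zero kills the whole diagonal. *)
Lemma mixed_entries_antidiagonal {R : idomainType} {t a b c d a' b' c' d' : R} :
  t != 0 -> 2 - t != 0 ->
  a * (1 - t) + b * (a' * (2 - t)) = a ->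
  c * (1 - t) + d * (a' * (2 - t)) = (1 - t) * c ->
  c * t + d * (a' * (t - 1)) = (1 - t) * (d * a') + t * c' ->
  d * b' = (1 - t) * (d * b') + t * d' ->
  a * a + b * c = 1 -> a * b + b * d = 0 -> c * b + d * d = 1 ->
  a' * a' + b' * c' = 1 ->
  [/\ a = 0, d = 0, c * b = 1 & [/\ a' = 0, d' = 0, b' = b & c' = c]].
Proof.
move=> t0 t2 ha hc hc' hd' sq11 sq12 sq22 sq11'.
have da'0 : d * a' = 0.
  apply: (mulIf t2); rewrite mul0r.
  by rewrite -mulrA; apply: (addrI (c * (1 - t))); rewrite hc addr0 mulrC.
have ta : t * a = b * a' * (2 - t).
  transitivity (a - a * (1 - t)); first ring.
  by rewrite -[X in X - _]ha; ring.
have [a0 d0] : a = 0 /\ d = 0.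
  move/eqP: da'0; rewrite mulf_eq0 => /orP[/eqP d0|/eqP a'0].
    split=> //; move: sq22 sq12; rewrite d0 !mulr0 !addr0 => cb1 ab0.
    by rewrite -[a]mulr1 -cb1 mulrCA ab0 mulr0.
  have a0 : a = 0.
    by apply: (mulfI t0); rewrite ta a'0 !(mulr0, mul0r).
  split=> //; move: sq11 sq12; rewrite a0 !mul0r !add0r => bc1 bd0.
  by rewrite -[d]mul1r -bc1 mulrAC bd0 mul0r.
move: sq11 sq22; rewrite a0 d0 !mul0r add0r addr0 => bc1 cb1.
have a'0 : a' = 0.
  have /esym/eqP := ta; rewrite a0 mulr0 mulf_eq0 (negbTE t2) orbF => /eqP ba'0.
  by rewrite -[a']mul1r -cb1 -mulrA ba'0 mulr0.
have c'c : c' = c.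
  by apply: (mulfI t0); move: hc'; rewrite d0 !mul0r addr0 mulr0 add0r mulrC.
split=> //; split=> //.
- by apply: (mulfI t0); move: hd'; rewrite d0 !mul0r !mulr0 add0r => <-.
- move: sq11'; rewrite a'0 c'c mul0r add0r => b'c1.
  by rewrite -[b']mulr1 -cb1 mulrA b'c1 mul1r.
Qed.

(** The mixed relation both forces the first block to be antidiagonal and
    transports it unchanged to the next index. *)
Lemma adjacent_antidiagonal {R : idomainType} {n : nat} {i j : 'I_n.-1} {t : R}
    {N N' : 'M[R]_2} :
  let M := mx22 (1 - t) t (2 - t) (t - 1) in
  t != 0 -> 2 - t != 0 -> j = i.+1 :> nat ->
  local2 i N *m local2 i N = 1%:M -> local2 j N' *m local2 j N' = 1%:M ->
  local2 i N *m (local2 j N' *m local2 i M) =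
    local2 j M *m (local2 i N *m local2 j N') ->
  [/\ N 0 1 \is a GRing.unit, N = mx22 0 (N 0 1) (N 0 1)^-1 0 & N' = N].
Proof.
move=> M t0 t2 hj sqN sqN' mixed.
have lt_z : (i.+2 < n)%N by have := ltn_ord j; rewrite hj; lia.
pose z := Ordinal lt_z; pose y := Ordinal (ltnW lt_z).
pose x := Ordinal (ltnW (ltnW lt_z)).
have hy' : y = j :> nat by rewrite hj.
have hz' : z = j.+1 :> nat by rewrite hj.
have hx : x = i :> nat by [].
have hy : y = i.+1 :> nat by [].
have hz : z = i.+2 :> nat by [].
have [sq11 sq12 _ sq22] := local2_sqr1 hx hy sqN.
have [sq11' _ _ _] := local2_sqr1 hy' hz' sqN'.
have [] := local2_mixed hx hy hz hj mixed.
rewrite !mxE /= => m1 m2 m3 m4.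
have [a0 d0 cb1 [a'0 d'0 b'b c'c]] :=
  mixed_entries_antidiagonal t0 t2 m1 m2 m3 m4 sq11 sq12 sq22 sq11'.
have ub : N 0 1 \is a GRing.unit by apply/unitrPr; exists (N 1 0); rewrite mulrC.
have c_inv : N 1 0 = (N 0 1)^-1 by rewrite -[LHS](mulrK ub) cb1 mul1r.
have ord2P (P : 'I_2 -> Prop) : P 0 -> P 1 -> forall k, P k.
  move=> P0 P1 [[|[|//]] hk].
  - by rewrite (_ : Ordinal hk = 0) //; exact: val_inj.
  - by rewrite (_ : Ordinal hk = 1) //; exact: val_inj.
split=> //; apply/matrixP.
  by elim/ord2P; elim/ord2P; rewrite mxE.
by elim/ord2P; elim/ord2P; rewrite ?a0 ?d0 ?a'0 ?d'0 ?b'b ?c'c.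
Qed.

(** * Regularity of [t] and [2 - t] *)

Lemma laurent_t_neq0 : laurent_t != 0.
Proof.
rewrite -val_eqE; change (laurent_val laurent_t != 0).
by rewrite /= tofrac_eq0 polyX_eq0.
Qed.

Lemma laurent_2t_neq0 : 2 - laurent_t != 0.
Proof.
apply/eqP => /(congr1 (\val : laurent -> _)).
rewrite rmorphB rmorph_nat [\val 0]rmorph0.
rewrite -(rmorph_nat (@tofrac _)) -rmorphB => /eqP.
(* In Z[X], the coefficient of [X] in [2 - X] is [-1]. *)
rewrite tofrac_eq0 => /eqP/(congr1 (fun p : {poly int} => p`_1)).
by rewrite coefB coefX -polyC_natr coefC coef0.
Qed.

(** * Relations of the virtual twin group and their images *)

Section VirtualTwin.
Context {n : nat} (theta : {multiplicative vtwin_group n -> GL laurent n}).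

Lemma vtwin_rho_sqr (i : 'I_n.-1) : (vtwin_rho i * vtwin_rho i = 1)%g.
Proof.
apply: etrans (pmul_class _ _ _) _.
exact/pclassP/(pcong_rel (vtwin_rsq i)).
Qed.

Lemma vtwin_mixedE (i j : 'I_n.-1) : j = i.+1 :> nat ->
  (vtwin_rho i * (vtwin_rho j * vtwin_s i) =
   vtwin_s j * (vtwin_rho i * vtwin_rho j))%g.
Proof.
move=> hj.
have rel := pcong_rel (vtwin_mixed hj).
rewrite -[LHS]/(pmul (vtwin_rho i) (pmul (vtwin_rho j) (vtwin_s i))).
rewrite -[RHS]/(pmul (vtwin_s j) (pmul (vtwin_rho i) (vtwin_rho j))).
by rewrite /vtwin_rho /vtwin_s /pgen !pmul_class; exact/pclassP.
Qed.

Lemma theta_rho_sqr (i : 'I_n.-1) :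
  (theta (vtwin_rho i) : 'M_n) *m theta (vtwin_rho i) = 1%:M.
Proof.
have sq : (theta (vtwin_rho i) * theta (vtwin_rho i) = 1)%g.
  (* [theta] is only known to respect products; [theta 1] is 1 because it is
     idempotent. *)
  by rewrite -gmulfM vtwin_rho_sqr; apply: (mulgI (theta 1%g));
    rewrite -gmulfM !mulg1.
exact: (congr1 (fun A : GL laurent n => A : 'M_n) sq).
Qed.

Lemma theta_mixed (i j : 'I_n.-1) : j = i.+1 :> nat ->
  (theta (vtwin_rho i) : 'M_n) *m
    ((theta (vtwin_rho j) : 'M_n) *m theta (vtwin_s i)) =
  (theta (vtwin_s j) : 'M_n) *m
    ((theta (vtwin_rho i) : 'M_n) *m theta (vtwin_rho j)).
Proof.
by move=> /vtwin_mixedE/(congr1 (fun g => theta g : 'M_n)); rewrite !gmulfM.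
Qed.

End VirtualTwin.

Theorem theorem12 (n : nat) (hn : (3 <= n)%N)
    (eta1 : {multiplicative twin_group n -> GL laurent n})
    (heta1 : forall i : 'I_n.-1,
       (eta1 (twin_s i) : 'M[laurent]_n) = local2 i eta1_block)
    (eta1hat : {multiplicative vtwin_group n -> GL laurent n})
    (hlocal : two_local eta1hat)
    (hext : forall i : 'I_n.-1, eta1hat (vtwin_s i) = eta1 (twin_s i)) :
  exists b : laurent, b \is a GRing.unit /\
    forall i : 'I_n.-1,
      (eta1hat (vtwin_s i) : 'M[laurent]_n) = local2 i eta1_block /\
      (eta1hat (vtwin_rho i) : 'M[laurent]_n)
        = local2 i (mx22 0 b b^-1 0).
Proof.
have seta i : (eta1hat (vtwin_s i) : 'M_n) = local2 i eta1_block.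
  by rewrite hext heta1.
have adj (i j : 'I_n.-1) (N N' : 'M_2) : j = i.+1 :> nat ->
    eta1hat (vtwin_rho i) = local2 i N :> 'M_n ->
    eta1hat (vtwin_rho j) = local2 j N' :> 'M_n ->
    [/\ N 0 1 \is a GRing.unit, N = mx22 0 (N 0 1) (N 0 1)^-1 0 & N' = N].
  move=> hj hN hN'.
  apply: (adjacent_antidiagonal laurent_t_neq0 laurent_2t_neq0 hj);
    rewrite -?hN -?hN' ?theta_rho_sqr //.
  by rewrite -!seta theta_mixed.
have lt0 : (0 < n.-1)%N by lia.
have lt1 : (1 < n.-1)%N by lia.
pose i0 := Ordinal lt0; pose i1 := Ordinal lt1.
have [_ [N [_ hN]]] := hlocal i0.
have [_ [N1 [_ hN1]]] := hlocal i1.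
have [ub defN _] := adj i0 i1 _ _ erefl hN hN1.
exists ((N : 'M_2) 0 1); split=> // i; split=> //.
rewrite -defN.
(* [n.-1 >= 2] provides the pair of adjacent indices 0 and 1 that fixes [b]; each
   pair [k], [k.+1] then carries the block one step further. *)
case: i => k; elim: k => [|k IHk] lt_k.
  by have -> : Ordinal lt_k = i0 by exact: val_inj.
have [_ [N' [_ hN']]] := hlocal (Ordinal lt_k).
by have [_ _ <-] := adj (Ordinal (ltnW lt_k)) (Ordinal lt_k) _ _ erefl (IHk _) hN'.
Qed.
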